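(* Let $p$ be a prime, $\alpha>0$, $\gamma>0$, $\gamma<\min(1,\alpha)$, $u_0\in\mathbb{R}$, and let $f:p^{\mathbb{Z}}\times\mathbb{R}\to\mathbb{R}$. Suppose there is a constant $M$ with $|f(p^{\ell},x)|\le M$ for all $\ell\in\mathbb{Z}$, $x\in\mathbb{R}$, and that $$|f(p^{\ell},x)-f(p^{\ell},y)|\le F_{\ell}|x-y|,\qquad x,y\in\mathbb{R},\ \ell\in\mathbb{Z},$$ where $0<F_{\ell}<p^{-\alpha\ell}$ for all $\ell\in\mathbb{Z}$. Let $N\in\mathbb{Z}$ and let $u=u(|t|_p)$ be a local solution, i.e. a radial real-valued function defined for $|t|_p\le p^N$ and satisfying there the integral equation $$u(|t|_p)=u_0+I^{\alpha}\left[|\cdot|_p^{-\gamma}f(|\cdot|_p,u(|\cdot|_p))\right](|t|_p).$$ Then $u$ can be extended to a global solution, i.e. to a radial real-valued function defined for all $t\in\mathbb{Q}_p$ and satisfying this integral equation for all $t\in\mathbb{Q}_p$.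
   Context: $\mathbb{Q}_p$ is the field of $p$-adic numbers with norm $|\cdot|_p$; $p^{\mathbb{Z}}=\{p^k:k\in\mathbb{Z}\}$; $dy$ is Haar measure on $\mathbb{Q}_p$ normalized so that the unit ball has measure $1$. A radial function is a function of $|t|_p$ only. For a function $\varphi$ the $p$-adic fractional integral is $$(I^{\alpha}\varphi)(x)=\frac{1-p^{-\alpha}}{1-p^{\alpha-1}}\int_{|y|_p\le|x|_p}\big(|x-y|_p^{\alpha-1}-|y|_p^{\alpha-1}\big)\varphi(y)\,dy\quad(\alpha\ne1),$$ $$(I^{1}\varphi)(x)=\frac{1-p}{p\log p}\int_{|y|_p\le|x|_p}\big(\log|x-y|_p-\log|y|_p\big)\varphi(y)\,dy,$$ whenever the integral converges absolutely; at $x=0$ the domain of integration has measure zero and the value is $0$. *)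

(* Defs.v *)
From HB Require Import structures.
From mathcomp Require Import all_boot all_order all_algebra.
From mathcomp Require Import generic_quotient ring_quotient.
From mathcomp Require Import all_classical all_reals all_analysis.
From mathcomp Require Import ring.

Set Implicit Arguments.
Unset Strict Implicit.
Unset Printing Implicit Defensive.

Import Order.TTheory GRing.Theory Num.Theory.
Import numFieldTopology.Exports numFieldNormedType.Exports.

Local Open Scope classical_set_scope.
Local Open Scope ring_scope.

Definition padic_val (p : nat) (q : rat) : int :=
  (logn p `|numq q|%N)%:Z - (logn p `|denq q|%N)%:Z.

(* As [logn p] vanishes identically when [p] is not prime, this is the trivial
   absolute value for such [p]; hence it is an absolute value for every [p],
   and no primality proof has to be carried by the types below. *)
Definition padic_abs (p : nat) (q : rat) : rat :=
  if q == 0 then 0 else p%:R ^ (- padic_val p q).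

Section PadicAbs.
Variable p : nat.
Implicit Types x y e q : rat.
Local Notation v := (padic_val p).
Local Notation abs := (padic_abs p).

Lemma padic_val_frac (a b : int) : a != 0 -> b != 0 ->
  v (a%:Q / b%:Q) = (logn p `|a|%N)%:Z - (logn p `|b|%N)%:Z.
Proof.
move=> a0 b0; set q := a%:Q / b%:Q.
have q0 : q != 0 by rewrite mulf_neq0 ?invr_eq0 ?intr_eq0.
have E : numq q * b = a * denq q.
  apply: (@intr_inj rat); rewrite !rmorphM /= numqE /q mulrAC divfK //.
  by rewrite intr_eq0.
have En : (`|numq q| * `|b| = `|a| * `|denq q|)%N by rewrite -!abszM E.
have := congr1 (logn p) En.
rewrite !lognM ?absz_gt0 ?numq_eq0 ?denq_neq0 // => /(congr1 Posz).
rewrite /padic_val !PoszD => H.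
by apply/eqP; rewrite subr_eq addrAC -subr_eq opprK H.
Qed.

Lemma padic_valM x y : x != 0 -> y != 0 -> v (x * y) = v x + v y.
Proof.
move=> x0 y0.
rewrite -{1}(divq_num_den x) -{1}(divq_num_den y) mulf_div -!rmorphM /=.
rewrite padic_val_frac ?mulf_neq0 ?numq_eq0 ?denq_neq0 // /padic_val !abszM.
rewrite !lognM ?absz_gt0 ?numq_eq0 ?denq_neq0 // !PoszD opprD.
by rewrite addrACA.
Qed.

Lemma logn_nprime n : ~~ prime p -> logn p n = 0%N.
Proof. by move=> pp; rewrite lognE (negbTE pp). Qed.

Lemma padic_val_nprime q : ~~ prime p -> v q = 0.
Proof. by move=> pp; rewrite /padic_val !logn_nprime. Qed.

Lemma padic_abs0 : abs 0 = 0. Proof. by rewrite /padic_abs eqxx. Qed.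

Lemma padic_abs_gt0 x : x != 0 -> 0 < abs x.
Proof.
move=> x0; rewrite /padic_abs (negbTE x0).
have [pp|pp] := boolP (prime p); last by rewrite padic_val_nprime // oppr0 expr0z.
by apply: exprz_gt0; rewrite ltr0n prime_gt0.
Qed.

Lemma padic_abs_ge0 x : 0 <= abs x.
Proof. by have [->|/padic_abs_gt0/ltW//] := eqVneq x 0; rewrite padic_abs0. Qed.

Lemma padic_abs_eq0 x : (abs x == 0) = (x == 0).
Proof.
have [->|x0] := eqVneq x 0; first by rewrite padic_abs0 eqxx.
by rewrite gt_eqF // padic_abs_gt0.
Qed.

Lemma padic_absM x y : abs (x * y) = abs x * abs y.
Proof.
have [->|x0] := eqVneq x 0; first by rewrite mul0r padic_abs0 mul0r.
have [->|y0] := eqVneq y 0; first by rewrite mulr0 padic_abs0 mulr0.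
rewrite /padic_abs mulf_eq0 (negbTE x0) (negbTE y0) /= padic_valM // opprD.
have [pp|pp] := boolP (prime p).
  by rewrite expfzDr // pnatr_eq0 -lt0n prime_gt0.
by rewrite !padic_val_nprime // oppr0 addr0 expr0z mulr1.
Qed.

Lemma padic_abs1 : abs 1 = 1.
Proof.
apply/eqP; have := padic_absM 1 1; rewrite mulr1 => /eqP.
by rewrite -subr_eq0 -{1}[abs 1]mulr1 -mulrBr mulf_eq0 padic_abs_eq0 oner_eq0 /=
  subr_eq0 eq_sym.
Qed.

Lemma padic_absN x : abs (- x) = abs x.
Proof.
by rewrite /padic_abs oppr_eq0 /padic_val numqN denqN abszN.
Qed.

Lemma padic_absB x y : abs (x - y) = abs (y - x).
Proof. by rewrite -padic_absN opprB. Qed.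

Lemma padic_absV x : abs x^-1 = (abs x)^-1.
Proof.
have [->|x0] := eqVneq x 0; first by rewrite !(invr0, padic_abs0).
apply: (mulfI (x := abs x)); first by rewrite padic_abs_eq0.
by rewrite -padic_absM !divff ?padic_abs_eq0 // padic_abs1.
Qed.

Lemma logn_addz (a b : int) : a != 0 -> b != 0 -> a + b != 0 ->
  (minn (logn p `|a|) (logn p `|b|) <= logn p `|(a + b)%R|)%N.
Proof.
move=> a0 b0 ab0.
have [pp|pp] := boolP (prime p); last by rewrite !logn_nprime.
rewrite -pfactor_dvdn ?absz_gt0 //.
set m := minn _ _.
have da : (Posz (p ^ m) %| a)%Z.
  by rewrite dvdzE /= pfactor_dvdn ?absz_gt0 // geq_minl.
have db : (Posz (p ^ m) %| b)%Z.
  by rewrite dvdzE /= pfactor_dvdn ?absz_gt0 // geq_minr.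
by have := rpredD da db; rewrite dvdzE.
Qed.

Lemma padic_abs_ultra x y : abs (x + y) <= Num.max (abs x) (abs y).
Proof.
have [->|x0] := eqVneq x 0; first by rewrite add0r le_max lexx orbT.
have [->|y0] := eqVneq y 0; first by rewrite addr0 le_max lexx.
have [->|xy0] := eqVneq (x + y) 0.
  by rewrite padic_abs0 le_max padic_abs_ge0.
have [pp|pp] := boolP (prime p); last first.
  by rewrite /padic_abs (negbTE x0) (negbTE y0) (negbTE xy0)
    !padic_val_nprime // le_max lexx.
set d := denq x * denq y.
have d0 : d != 0 by rewrite mulf_neq0 ?denq_neq0.
have xE : x = (numq x * denq y)%:Q / d%:Q.
  by rewrite /d !rmorphM /= -mulf_div divff ?mulr1 ?divq_num_den // intr_eq0 denq_neq0.
have yE : y = (denq x * numq y)%:Q / d%:Q.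
  by rewrite /d !rmorphM /= -mulf_div divff ?mul1r ?divq_num_den // intr_eq0 denq_neq0.
set a := numq x * denq y in xE; set b := denq x * numq y in yE.
have a0 : a != 0 by rewrite mulf_neq0 ?numq_eq0 ?denq_neq0.
have b0 : b != 0 by rewrite mulf_neq0 ?numq_eq0 ?denq_neq0.
have sE : x + y = (a + b)%:Q / d%:Q by rewrite xE yE -mulrDl rmorphD.
have ab0 : a + b != 0.
  by apply: contra_neq xy0 => e; rewrite sE e mul0r.
have L := logn_addz a0 b0 ab0.
have p1 : 1 <= p%:R :> rat by rewrite ler1n prime_gt0.
rewrite /padic_abs (negbTE x0) (negbTE y0) (negbTE xy0).
rewrite {1}sE [in v x]xE [in v y]yE !padic_val_frac //.
have [ab|ba] := leqP (logn p `|a|) (logn p `|b|).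
- rewrite le_max; apply/orP; left; apply: ler_weXz2l => //.
  rewrite lerN2 lerD2r lez_nat.
  by apply: leq_trans L; rewrite (minn_idPl ab).
- rewrite le_max; apply/orP; right; apply: ler_weXz2l => //.
  rewrite lerN2 lerD2r lez_nat.
  by apply: leq_trans L; rewrite (minn_idPr (ltnW ba)).
Qed.

Lemma padic_absD_lt x y e : abs x < e -> abs y < e -> abs (x + y) < e.
Proof.
by move=> xe ye; apply: le_lt_trans (padic_abs_ultra x y) _; rewrite gt_max xe ye.
Qed.

Lemma padic_abs_eq x y : abs (x - y) < abs y -> abs x = abs y.
Proof.
move=> h; apply/eqP; rewrite eq_le; apply/andP; split.
  have := padic_abs_ultra (x - y) y; rewrite subrK => /le_trans; apply.
  by rewrite ge_max lexx (ltW h).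
rewrite leNgt; apply/negP => h'.
have := padic_absD_lt h' (etrans (congr1 (< abs y) (padic_absB y x)) h).
by rewrite addrC subrK ltxx.
Qed.

End PadicAbs.

Definition padic_cauchy (p : nat) (u : nat -> rat) : Prop :=
  forall e : rat, 0 < e -> exists N, forall m n, (N <= m)%N -> (N <= n)%N ->
    padic_abs p (u m - u n) < e.

Definition padic_null (p : nat) (u : nat -> rat) : Prop :=
  forall e : rat, 0 < e -> exists N, forall n, (N <= n)%N ->
    padic_abs p (u n) < e.

Definition cauchy_mem (p : nat) : {pred nat -> rat} :=
  fun u => `[< padic_cauchy p u >].

Section CauchyRing.
Variable p : nat.
Local Notation abs := (padic_abs p).

Lemma padic_cauchy_bounded u : padic_cauchy p u ->
  exists2 B : rat, 0 < B & exists N, forall n, (N <= n)%N -> abs (u n) < B.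
Proof.
move=> /(_ 1 ltr01)[N uN].
exists (abs (u N) + 1); first by rewrite ltr_wpDl // padic_abs_ge0.
exists N => n Nn; rewrite -(subrK (u N) (u n)).
apply: le_lt_trans (padic_abs_ultra _ _ _) _; rewrite gt_max.
by rewrite ltrDl ltr01 andbT ltr_wpDl ?padic_abs_ge0 ?uN.
Qed.

Lemma cauchy_subring : subring_closed (cauchy_mem p).
Proof.
split.
- apply/asboolP => e e0; exists 0%N => m n _ _.
  by rewrite [X in abs X](_ : _ = 0) ?padic_abs0 // subrr.
- move=> u w /asboolP cu /asboolP cw; apply/asboolP => e e0.
  have [N uN] := cu e e0; have [M wM] := cw e e0.
  exists (maxn N M) => m n; rewrite !geq_max => /andP[Nm Mm] /andP[Nn Mn].
  rewrite [X in abs X](_ : _ = (u m - u n) + (w n - w m)).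
    by apply: padic_absD_lt; [exact: uN | exact: wM].
  by rewrite !fctE; ring.
- move=> u w /asboolP cu /asboolP cw; apply/asboolP => e e0.
  have [B B0 [N1 uB]] := padic_cauchy_bounded cu.
  have [C C0 [N2 wC]] := padic_cauchy_bounded cw.
  have [N3 uN] := cu (e / C) (divr_gt0 e0 C0).
  have [N4 wN] := cw (e / B) (divr_gt0 e0 B0).
  exists (maxn (maxn N1 N2) (maxn N3 N4)) => m n; rewrite !geq_max.
  move=> /andP[/andP[m1 m2] /andP[m3 m4]] /andP[/andP[n1 n2] /andP[n3 n4]].
  rewrite [X in abs X](_ : _ = (u m - u n) * w m + u n * (w m - w n)); last first.
    by rewrite !fctE; ring.
  apply: padic_absD_lt; rewrite padic_absM.
  - have := uN m n m3 n3; rewrite ltr_pdivlMr //; apply: le_lt_trans.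
    by rewrite ler_wpM2l ?padic_abs_ge0 // ltW // wC.
  - have := wN m n m4 n4; rewrite ltr_pdivlMr // mulrC; apply: le_lt_trans.
    by rewrite mulrC [leRHS]mulrC ler_wpM2r ?padic_abs_ge0 // ltW // uB.
Qed.

HB.instance Definition _ :=
  GRing.isSubringClosed.Build (nat -> rat) (cauchy_mem p) cauchy_subring.

End CauchyRing.

Record cauchy_seq (p : nat) := CauchySeq {
  cseq :> nat -> rat;
  _ : cseq \in cauchy_mem p }.

HB.instance Definition _ p := [isSub for @cseq p].
HB.instance Definition _ p := [Choice of cauchy_seq p by <:].
HB.instance Definition _ p :=
  [SubChoice_isSubComNzRing of cauchy_seq p by <:].

Definition null_mem (p : nat) : {pred cauchy_seq p} :=
  fun u => `[< padic_null p u >].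
Arguments null_mem p _ : clear implicits.

Section NullIdeal.
Variable p : nat.
Local Notation abs := (padic_abs p).

Lemma cseqP (u : cauchy_seq p) : padic_cauchy p u.
Proof. by case: u => u /= /asboolP. Qed.

Lemma cseqM (u w : cauchy_seq p) n : (u * w) n = u n * w n.
Proof. by []. Qed.

Lemma cseqD (u w : cauchy_seq p) n : (u + w) n = u n + w n.
Proof. by []. Qed.

Lemma cseqB (u w : cauchy_seq p) n : (u - w) n = u n - w n.
Proof. by []. Qed.

Lemma cseq1 n : (1 : cauchy_seq p) n = 1.
Proof. by []. Qed.

Lemma cseq_mul_null (u : cauchy_seq p) w :
  padic_null p w -> padic_null p (fun n => u n * w n).
Proof.
move=> w0 e e0; have [B B0 [N uB]] := padic_cauchy_bounded (cseqP u).
have [M wM] := w0 (e / B) (divr_gt0 e0 B0).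
exists (maxn N M) => n; rewrite geq_max => /andP[Nn Mn].
have := wM n Mn; rewrite ltr_pdivlMr // padic_absM mulrC; apply: le_lt_trans.
by rewrite ler_wpM2r ?padic_abs_ge0 // ltW // uB.
Qed.

Lemma padic_nullD u w :
  padic_null p u -> padic_null p w -> padic_null p (fun n => u n + w n).
Proof.
move=> u0 w0 e e0; have [N uN] := u0 e e0; have [M wM] := w0 e e0.
exists (maxn N M) => n; rewrite geq_max => /andP[Nn Mn].
by apply: padic_absD_lt; [exact: uN | exact: wM].
Qed.

Lemma null_idealr : idealr_closed (null_mem p).
Proof.
split.
- apply/asboolP => e e0; exists 0%N => n _.
  by rewrite [X in abs X](_ : _ = 0) ?padic_abs0.
- apply/asboolP => /(_ 1 ltr01)[N /(_ N (leqnn N))].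
  by rewrite cseq1 padic_abs1 ltxx.
- move=> a u w /asboolP u0 /asboolP w0; apply/asboolP.
  by apply: (padic_nullD (cseq_mul_null a u0) w0).
Qed.

HB.instance Definition _ := isIdealr.Build (cauchy_seq p) (null_mem p) null_idealr.

Lemma padic_abs_eventually (u : cauchy_seq p) : u \notin null_mem p ->
  exists2 c : rat, 0 < c & exists N, forall n, (N <= n)%N -> abs (u n) = c.
Proof.
move=> /asboolPn /existsNP[e /not_implyP[e0 /forallNP nu]].
have [N uN] := cseqP u e0.
have /existsNP[n0 /not_implyP[Nn0 /negP]] := nu N.
rewrite -leNgt => e_un0.
exists (abs (u n0)); first exact: lt_le_trans e_un0.
by exists N => n Nn; apply: padic_abs_eq; apply: lt_le_trans e_un0; apply: uN.
Qed.

Lemma cseq_inv (u : cauchy_seq p) : u \notin null_mem p ->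
  exists w : cauchy_seq p, w * u - 1 \in null_mem p.
Proof.
move=> /padic_abs_eventually[c c0 [N uc]].
have u0 n : (N <= n)%N -> u n != 0.
  by move=> Nn; rewrite -(padic_abs_eq0 p) uc // gt_eqF.
have cw : (fun n => (u n)^-1) \in cauchy_mem p.
  apply/asboolP => e e0.
  have [M uM] := cseqP u (mulr_gt0 e0 (mulr_gt0 c0 c0)).
  exists (maxn N M) => m n; rewrite !geq_max => /andP[Nm Mm] /andP[Nn Mn].
  have -> : (u m)^-1 - (u n)^-1 = (u n - u m) * ((u m)^-1 * (u n)^-1).
    by field; rewrite !u0.
  rewrite !padic_absM !padic_absV !uc // -invfM ltr_pdivrMr ?mulr_gt0 //.
  exact: uM.
exists (CauchySeq cw); apply/asboolP => e e0; exists N => n Nn.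
by rewrite cseqB cseqM cseq1 /= mulVf ?u0 // subrr padic_abs0.
Qed.

End NullIdeal.

(* [R] only serves as the codomain of the norm defined below. *)
Definition padic (R : realType) (p : nat) : Type := {ideal_quot (null_mem p)}.

HB.instance Definition _ R p := GRing.ComNzRing.on (padic R p).

Section PadicField.
Variables (R : realType) (p : nat).
Local Notation Qp := (padic R p).
Local Notation abs := (padic_abs p).

Definition padic_pi (u : cauchy_seq p) : Qp := \pi_{ideal_quot (null_mem p)}%qT u.
Definition padic_repr (x : Qp) : cauchy_seq p :=
  repr (x : {ideal_quot (null_mem p)}).

Lemma padic_reprK x : padic_pi (padic_repr x) = x.
Proof. exact: reprK. Qed.

Lemma padic_pi_eq u w : padic_pi u = padic_pi w <-> u - w \in null_mem p.
Proof.
rewrite Quotient.idealrBE; split=> [e|/eqP //]; exact/eqP.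
Qed.

Lemma padic_piM u w : padic_pi (u * w) = padic_pi u * padic_pi w.
Proof. exact: (rmorphM \pi_{ideal_quot (null_mem p)}%qT). Qed.
Lemma padic_piD u w : padic_pi (u + w) = padic_pi u + padic_pi w.
Proof. exact: (rmorphD \pi_{ideal_quot (null_mem p)}%qT). Qed.
Lemma padic_piN u : padic_pi (- u) = - padic_pi u.
Proof. exact: (rmorphN \pi_{ideal_quot (null_mem p)}%qT). Qed.
Lemma padic_pi1 : padic_pi 1 = 1.
Proof. exact: (rmorph1 \pi_{ideal_quot (null_mem p)}%qT). Qed.
Lemma padic_pi0 : padic_pi 0 = 0.
Proof. exact: (rmorph0 \pi_{ideal_quot (null_mem p)}%qT). Qed.

Lemma padic_pi_eq0 u : padic_pi u = 0 <-> u \in null_mem p.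
Proof. by rewrite -padic_pi0 padic_pi_eq subr0. Qed.

Definition padic_inv (x : Qp) : Qp := xget 0 [set y | y * x = 1].

Lemma padic_mulVf x : x != 0 -> padic_inv x * x = 1.
Proof.
rewrite -{1}(padic_reprK x) => x0.
have /cseq_inv[w ww] : padic_repr x \notin null_mem p.
  by apply: contra_neqN x0 => /padic_pi_eq0.
rewrite /padic_inv; case: xgetP => [y _ //|/(_ (padic_pi w)) []] /=.
by rewrite -{1}(padic_reprK x) -padic_piM -padic_pi1; apply/padic_pi_eq.
Qed.

Lemma padic_inv0 : padic_inv 0 = 0.
Proof.
rewrite /padic_inv; case: xgetP => // y _ /= /eqP.
by rewrite mulr0 eq_sym oner_eq0.
Qed.

HB.instance Definition _ :=
  GRing.ComNzRing_isField.Build Qp padic_mulVf padic_inv0.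

Definition padic_norm (x : Qp) : R :=
  lim ((ratr (abs (padic_repr x n)) : R) @[n --> \oo]).

Lemma ratr_null_cvg (u : cauchy_seq p) : u \in null_mem p ->
  (ratr (abs (u n)) : R) @[n --> \oo] --> (0 : R).
Proof.
move=> /asboolP u0; apply/cvgrPdist_lt => e e0.
have [q /[!in_itv]/= /andP[q0 qe]] := rat_in_itvoo e0.
rewrite ltr0q in q0; have [N uN] := u0 q q0.
near=> n; rewrite sub0r normrN ger0_norm ?ler0q ?padic_abs_ge0 //.
apply: lt_trans qe; rewrite ltr_rat; apply: uN; near: n; exact: nbhs_infty_ge.
Unshelve. all: by end_near. Qed.

Lemma eventually_cst_cvg (u : cauchy_seq p) c N :
  (forall n, (N <= n)%N -> abs (u n) = c) ->
  (ratr (abs (u n)) : R) @[n --> \oo] --> (ratr c : R).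
Proof.
move=> uc; apply: cvg_near_cst; near=> n.
by rewrite uc //; near: n; exact: nbhs_infty_ge.
Unshelve. all: by end_near. Qed.

Lemma padic_norm_pi (u : cauchy_seq p) :
  (ratr (abs (u n)) : R) @[n --> \oo] --> padic_norm (padic_pi u).
Proof.
set x := padic_pi u; set w := padic_repr x.
have uw : u - w \in null_mem p by apply/padic_pi_eq; rewrite padic_reprK.
have [u0|u0] := boolP (u \in null_mem p).
  have w0 : w \in null_mem p.
    by apply/padic_pi_eq0; rewrite padic_reprK; apply/padic_pi_eq0.
  rewrite /padic_norm (cvg_lim _ (ratr_null_cvg w0)) //.
  exact: ratr_null_cvg.
have [c c0 [N uc]] := padic_abs_eventually u0.
have /asboolP/(_ c c0)[M uwM] := uw.
have wc n : (maxn N M <= n)%N -> abs (w n) = c.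
  rewrite geq_max => /andP[Nn Mn]; rewrite -(uc n Nn); apply: padic_abs_eq.
  by rewrite padic_absB uc // -cseqB; exact: uwM.
rewrite /padic_norm (cvg_lim _ (eventually_cst_cvg wc)) //.
exact: eventually_cst_cvg uc.
Qed.

Lemma padic_norm_cvg x :
  (ratr (abs (padic_repr x n)) : R) @[n --> \oo] --> padic_norm x.
Proof. by rewrite -{2}(padic_reprK x); exact: padic_norm_pi. Qed.

Lemma padic_norm_ge0 x : 0 <= padic_norm x.
Proof.
rewrite -(cvg_lim _ (@padic_norm_cvg x)) //; apply: limr_ge.
  by apply/cvg_ex; exists (padic_norm x); exact: padic_norm_cvg.
by apply: nearW => n; rewrite ler0q padic_abs_ge0.
Qed.

Lemma padic_norm0 : padic_norm 0 = 0.
Proof.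
rewrite -padic_pi0 -(cvg_lim _ (@padic_norm_pi 0)) //.
by apply: cvg_lim => //; apply: ratr_null_cvg; apply/padic_pi_eq0; exact: padic_pi0.
Qed.

Lemma padic_norm_eq0 x : padic_norm x = 0 -> x = 0.
Proof.
rewrite -(padic_reprK x); set u := padic_repr x => nu.
apply/padic_pi_eq0; apply: contrapT => /negP /padic_abs_eventually[c c0 [N uc]].
have := @padic_norm_pi u; rewrite nu => l0.
have := cvg_lim (@Rhausdorff R) l0.
rewrite (cvg_lim (@Rhausdorff R) (eventually_cst_cvg uc)) => rc0.
by move: c0; rewrite -(ltr0q R) rc0 ltxx.
Qed.

Lemma padic_normM x y : padic_norm (x * y) = padic_norm x * padic_norm y.
Proof.
rewrite -{1}(padic_reprK x) -{1}(padic_reprK y) -padic_piM.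
rewrite -(cvg_lim _ (@padic_norm_pi (padic_repr x * padic_repr y))) //.
apply: cvg_lim => //; under eq_fun do rewrite cseqM padic_absM rmorphM /=.
by apply: cvgM; exact: padic_norm_cvg.
Qed.

Lemma padic_normN x : padic_norm (- x) = padic_norm x.
Proof.
rewrite -{1}(padic_reprK x) -padic_piN.
rewrite -(cvg_lim _ (@padic_norm_pi (- padic_repr x))) //.
apply: cvg_lim => //.
rewrite (_ : (fun n => _) = fun n => ratr (abs (padic_repr x n))).
  exact: padic_norm_cvg.
by apply/funext => n; rewrite -[_ n]/(- padic_repr x n) padic_absN.
Qed.

Lemma padic_norm_ultra x y :
  padic_norm (x + y) <= Num.max (padic_norm x) (padic_norm y).
Proof.
rewrite -{1}(padic_reprK x) -{1}(padic_reprK y) -padic_piD maxr_absE.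
apply: (ler_cvg_to (@padic_norm_pi (padic_repr x + padic_repr y))).
  apply: cvgMl; apply: cvgD.
    by apply: cvgD; exact: padic_norm_cvg.
  by apply: cvg_norm; apply: cvgB; exact: padic_norm_cvg.
apply: nearW => n; rewrite -maxr_absE.
have := padic_abs_ultra p (padic_repr x n) (padic_repr y n).
by rewrite !le_max cseqD !ler_rat.
Qed.

Lemma padic_norm_le x y : padic_norm (x + y) <= padic_norm x + padic_norm y.
Proof.
apply: le_trans (padic_norm_ultra x y) _.
by rewrite ge_max lerDl lerDr !padic_norm_ge0.
Qed.

Lemma cseq_nat n k : (n%:R : cauchy_seq p) k = n%:R.
Proof. by elim: n => // n IH; rewrite !mulrS cseqD IH. Qed.

Lemma padic_norm_nat n : padic_norm n%:R = ratr (abs n%:R).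
Proof.
have <- : padic_pi n%:R = n%:R.
  by elim: n => [|n IH]; [exact: padic_pi0 | rewrite !mulrS padic_piD IH padic_pi1].
rewrite -(cvg_lim _ (@padic_norm_pi n%:R)) //; apply: cvg_lim => //.
by under eq_fun do rewrite cseq_nat; exact: cvg_cst.
Qed.

Lemma padic_norm1 : padic_norm 1 = 1.
Proof. by rewrite -[1 in LHS]/(1%:R) padic_norm_nat padic_abs1 rmorph1. Qed.

Lemma padic_normV x : padic_norm x^-1 = (padic_norm x)^-1.
Proof.
have [->|x0] := eqVneq x 0; first by rewrite !(invr0, padic_norm0).
have nx0 : padic_norm x != 0 by apply: contra_neq x0; exact: padic_norm_eq0.
by apply: (mulfI nx0); rewrite -padic_normM !divff // padic_norm1.
Qed.

(* The norm extends the p-adic absolute value of the rationals. *)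
Lemma padic_norm_rat (q : rat) : padic_norm (ratr q) = ratr (abs q).
Proof.
have normz (z : int) : padic_norm z%:~R = ratr (abs z%:~R).
  case: z => n; first exact: padic_norm_nat.
  by rewrite NegzE !rmorphN /= padic_normN padic_absN padic_norm_nat.
rewrite {1}/ratr -[X in abs X]divq_num_den padic_normM padic_normV !normz.
by rewrite padic_absM padic_absV rmorphM /= fmorphV.
Qed.

(* The library's normed structures require [`|x *+ n| = `|x| *+ n], which the
   p-adic norm violates; the topology is therefore built from the metric. *)
Definition padic_mball (x : Qp) (r : R) : set Qp :=
  [set y | padic_norm (x - y) < r].

Definition padic_ent : set_system (Qp * Qp) := entourage_ padic_mball.

Definition padic_nbhs (x : Qp) : set_system Qp := nbhs_ padic_ent x.

Lemma padic_nbhsE : padic_nbhs = nbhs_ padic_ent. Proof. by []. Qed.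

HB.instance Definition _ := hasNbhs.Build Qp padic_nbhs.

Lemma padic_mball_center x (e : R) : 0 < e -> padic_mball x e x.
Proof. by rewrite /padic_mball /= subrr padic_norm0. Qed.

Lemma padic_mball_sym x y (e : R) : padic_mball x e y -> padic_mball y e x.
Proof. by rewrite /padic_mball /= -padic_normN opprB. Qed.

Lemma padic_mball_triangle x y z e1 e2 :
  padic_mball x e1 y -> padic_mball y e2 z -> padic_mball x (e1 + e2) z.
Proof.
rewrite /padic_mball /= => xy yz; rewrite -(subrK y x) -addrA.
exact: le_lt_trans (padic_norm_le _ _) (ltrD xy yz).
Qed.

Lemma padic_entE : padic_ent = entourage_ padic_mball. Proof. by []. Qed.

HB.instance Definition _ := @Nbhs_isPseudoMetric.Build R Qp padic_ent
  padic_nbhsE padic_mball padic_mball_center padic_mball_sym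
  padic_mball_triangle padic_entE.

HB.instance Definition _ := isPointed.Build Qp 0.

HB.instance Definition _ :=
  Measurable.copy Qp (g_sigma_algebraType (@open Qp)).

End PadicField.

Section FractionalIntegral.
Variables (R : realType) (p : nat).
Local Notation Qp := (padic R p).

Definition padic_disc (r : R) : set Qp := [set y | padic_norm y <= r].

Definition normalized_haar (mu : {measure set Qp -> \bar R}) : Prop :=
  (forall (a : Qp) (A : set Qp), measurable A ->
     mu [set a + x | x in A] = mu A) /\ mu (padic_disc 1) = 1%E.

Definition frac_const (alpha : R) : R :=
  if alpha == 1 then (1 - p%:R) / (p%:R * ln p%:R)
  else (1 - p%:R `^ (- alpha)) / (1 - p%:R `^ (alpha - 1)).

(* The junk values [0 `^ (alpha - 1)] and [ln 0] only occur for [y = x] and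
   [y = 0], hence on a null set. *)
Definition frac_kernel (alpha : R) (x y : Qp) : R :=
  if alpha == 1 then ln (padic_norm (x - y)) - ln (padic_norm y)
  else padic_norm (x - y) `^ (alpha - 1) - padic_norm y `^ (alpha - 1).

Definition frac_defined (mu : {measure set Qp -> \bar R}) (alpha : R)
    (phi : Qp -> R) (x : Qp) : Prop :=
  mu.-integrable (padic_disc (padic_norm x))
    (fun y => (frac_kernel alpha x y * phi y)%:E).

Definition frac_integral (mu : {measure set Qp -> \bar R}) (alpha : R)
    (phi : Qp -> R) (x : Qp) : R :=
  frac_const alpha *
  \int[mu]_(y in padic_disc (padic_norm x)) (frac_kernel alpha x y * phi y).

Definition radial_on (D : set Qp) (u : Qp -> R) : Prop :=
  exists g : R -> R, forall t, D t -> u t = g (padic_norm t).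

(* [f] is only used on p^Z x R, up to a null set: [padic_norm y] is an integral
   power of [p] unless [y = 0]. *)
Definition solves_at (mu : {measure set Qp -> \bar R}) (alpha gamma u0 : R)
    (f : R -> R -> R) (u : Qp -> R) (t : Qp) : Prop :=
  let phi y := padic_norm y `^ (- gamma) * f (padic_norm y) (u y) in
  frac_defined mu alpha phi t /\ u t = u0 + frac_integral mu alpha phi t.

End FractionalIntegral.

(* Main.v *)
Require Import Defs.
From mathcomp Require Import all_boot all_order all_algebra.
From mathcomp Require Import all_classical all_reals all_analysis.
From mathcomp Require Import measurable_realfun.
From mathcomp Require Import ring lra zify.

Set Implicit Arguments.
Unset Strict Implicit.
Unset Printing Implicit Defensive.

Import Order.TTheory GRing.Theory Num.Theory.
Import numFieldTopology.Exports numFieldNormedType.Exports.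
Local Open Scope classical_set_scope.
Local Open Scope ring_scope.

(** The solution is extended one sphere at a time. The norm takes only the
    values [p ^ l] and 0, and the equation at [t] involves the unknown on the
    disc of radius [|t|] only; so once a radial solution is known for
    [|t| <= p ^ (n - 1)], what is missing at radius [p ^ n] is one real number
    [z], the value on that sphere.

    This number need only solve a scalar equation. Let [k] be the function
    such that the kernel of the fractional integral is [k |x - y| - k |y|], and
    let the density be [w |y|]. For [|x| = p ^ n] the kernel has integral zero
    over the disc [D] of radius [p ^ n], because translation by [x] preserves
    [D] and the measure ([frac_kernel_mean0]). One may therefore replace
    [w |y|] by [w |y| - w (p ^ n)] in the integral. This difference vanishes on
    the outer sphere, while inside it [|x - y| = p ^ n]; so the integral is
    that of the radial function [(k (p ^ n) - k |y|) (w |y| - w (p ^ n))]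
    ([frac_integral_radial]). It depends on [|x|] alone, and it is affine in
    [w (p ^ n)], with the other values of [w] entering only through radii less
    than [p ^ n]. With [w r = r ^ (- gamma) f (r, u r)] the equation at radius
    [p ^ n] becomes [z = a + b f (p ^ n, z)] with known [a] and [b]. As
    [f (p ^ n, .)] is continuous and bounded, the intermediate value theorem
    gives a solution ([bounded_affine_fixpoint], [extend_to_sphere]).

    The integrals converge because a function of the norm that is bounded by a
    multiple of [r ^ s] with [s > -1] is integrable on discs
    ([integrable_radial]); here [s] is [alpha - 1], [- gamma] or
    [alpha - 1 - gamma], and for [alpha = 1] the logarithm costs an
    arbitrarily small power. That criterion rests on the volume [p ^ n] of the
    disc of radius [p ^ n] ([haar_disc]), which follows from invariance and the
    fact that a disc is a disjoint union of [p] translates of the next smaller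
    one ([padic_residue], [haar_discS]). *)

(** * The value group and the residue field of the p-adic numbers *)

Section ValueGroup.
Variables (R : realType) (p : nat).
Hypothesis p_prime : prime p.
Local Notation Qp := (padic R p).
Local Notation q := (p%:R : R).

Let p_gt1 : (1 < p)%N. Proof. exact: prime_gt1. Qed.

Lemma natr_prime_gt1 : 1 < q. Proof. by rewrite ltr1n. Qed.

Lemma natr_prime_gt0 : 0 < q. Proof. exact: lt_trans natr_prime_gt1. Qed.

Lemma natr_prime_neq0 : q != 0. Proof. by rewrite gt_eqF// natr_prime_gt0. Qed.

Lemma exprz_prime_gt0 (l : int) : 0 < q ^ l.
Proof. exact: exprz_gt0 natr_prime_gt0. Qed.

Lemma exprz_primeS (l : int) : q ^ (l + 1) = q * q ^ l.
Proof. by rewrite expfzDr ?natr_prime_neq0// expr1z mulrC. Qed.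

Lemma exprz_prime_inj : injective (fun l : int => q ^ l).
Proof.
move=> l m /= e; apply/eqP; rewrite eq_le.
by rewrite -!(ler_eXz2l natr_prime_gt1) e lexx.
Qed.

(** The absolute value is eventually constant along a Cauchy sequence that is
    not null, so the completion has no new values of the norm. *)
Lemma padic_norm_exprz (x : Qp) : x != 0 -> exists l : int, padic_norm x = q ^ l.
Proof.
move=> x0; set u := padic_repr x.
have u0 : u \notin null_mem p.
  apply: contra_neqN x0 => /(padic_pi_eq0 R).
  by rewrite padic_reprK.
have [c c0 [N uc]] := padic_abs_eventually u0.
have -> : padic_norm x = ratr c.
  rewrite -(cvg_lim (@Rhausdorff R) (@padic_norm_cvg R p x)).
  exact: (cvg_lim (@Rhausdorff R) (@eventually_cst_cvg R _ _ _ _ uc)).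
have uN0 : u N != 0 by rewrite -(padic_abs_eq0 p) uc // gt_eqF.
exists (- padic_val p (u N)).
by rewrite -(uc N (leqnn N)) /padic_abs (negbTE uN0) fmorphXz/= ratr_nat.
Qed.

Lemma padic_normB (x y : Qp) : padic_norm (x - y) = padic_norm (y - x).
Proof. by rewrite -padic_normN opprB. Qed.

Lemma padic_norm_ltD (x y : Qp) (r : R) :
  padic_norm x < r -> padic_norm y < r -> padic_norm (x + y) < r.
Proof.
by move=> xr yr; apply: le_lt_trans (padic_norm_ultra x y) _; rewrite gt_max xr.
Qed.

Lemma padic_norm_leD (x y : Qp) (r : R) :
  padic_norm x <= r -> padic_norm y <= r -> padic_norm (x + y) <= r.
Proof.
by move=> xr yr; apply: le_trans (padic_norm_ultra x y) _; rewrite ge_max xr.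
Qed.

Lemma padic_norm_domin (x y : Qp) :
  padic_norm y < padic_norm x -> padic_norm (x - y) = padic_norm x.
Proof.
move=> yx; apply/eqP; rewrite eq_le; apply/andP; split.
  by apply: padic_norm_leD => //; rewrite padic_normN ltW.
rewrite leNgt; apply/negP => h.
by have := padic_norm_ltD h yx; rewrite subrK ltxx.
Qed.

Lemma padic_abs_prime : padic_abs p p%:R = p%:R^-1.
Proof.
rewrite /padic_abs pnatr_eq0 -[_ == 0%N]negbK -lt0n prime_gt0//=.
have := @padic_val_frac p p%:Z 1 _ (oner_neq0 _); rewrite divr1 => ->.
  by rewrite /= logn_prime// eqxx logn1 subr0.
by rewrite -lt0n prime_gt0.
Qed.

Lemma padic_abs_int_le1 (z : int) : padic_abs p z%:~R <= 1.
Proof.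
rewrite /padic_abs; have [->|z0] := eqVneq z 0; first by rewrite eqxx ler01.
rewrite intr_eq0 (negbTE z0) -[z%:~R]divr1 (padic_val_frac p z0 (oner_neq0 _)).
rewrite logn1 subr0 -[leRHS](expr0z (p%:R : rat)).
by rewrite ler_eXz2l ?ltr1n// oppr_le0.
Qed.

Lemma padic_abs_unit (z : int) : ~~ (p%:Z %| z)%Z -> padic_abs p z%:~R = 1.
Proof.
move=> nz; have z0 : z != 0 by apply: contraNneq nz => ->; rewrite dvdz0.
rewrite /padic_abs intr_eq0 (negbTE z0) -[z%:~R]divr1.
rewrite (padic_val_frac p z0 (oner_neq0 _)) logn1 subr0.
suff -> : logn p `|z| = 0%N by rewrite oppr0.
apply/eqP; rewrite lognE p_prime absz_gt0 z0 /=.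
by move: nz; rewrite dvdzE /=; case: (p %| `|z|)%N.
Qed.

Lemma padic_abs_dvd (z : int) : (p%:Z %| z)%Z -> padic_abs p z%:~R <= p%:R^-1.
Proof.
move=> /dvdzP[k ->]; rewrite rmorphM/= padic_absM.
have -> : p%:Z%:~R = p%:R :> rat by [].
by rewrite padic_abs_prime ler_piMl ?invr_ge0// padic_abs_int_le1.
Qed.

(** The denominator of such an [r] is prime to [p], so a Bezout relation inverts
    it modulo [p] and supplies the residue. *)
Lemma padic_abs_residue (r : rat) : padic_abs p r <= 1 ->
  exists i : 'I_p, padic_abs p (r - i%:R) <= p%:R^-1.
Proof.
move=> r1.
have nd : ~~ (p%:Z %| denq r)%Z.
  apply/negP => pd; move: r1; apply/negP; rewrite -ltNge.
  have pn : ~~ (p%:Z %| numq r)%Z.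
    apply/negP => pn; have := coprime_num_den r.
    rewrite /coprime => /eqP e.
    have : (p %| gcdn `|numq r| `|denq r|)%N.
      by rewrite dvdn_gcd; move: pn pd; rewrite !dvdzE /= => -> ->.
    by rewrite e dvdn1 => /eqP p1; move: p_gt1; rewrite p1.
  rewrite -(divq_num_den r) padic_absM padic_absV padic_abs_unit// mul1r.
  have d0 : (denq r)%:~R != 0 :> rat by rewrite intr_eq0 denq_neq0.
  rewrite invf_gt1; last exact: padic_abs_gt0.
  apply: le_lt_trans (padic_abs_dvd pd) _.
  by rewrite invf_lt1 ?ltr1n// ltr0n prime_gt0.
have cop : coprimez (denq r) p%:Z.
  by rewrite coprimezE coprime_sym prime_coprime//.
have [s [t st]] := Bezoutz (denq r) p%:Z.
have {cop} st1 : s * denq r + t * p%:Z = 1 by rewrite st; exact/eqP.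
have pz0 : p%:Z != 0 by rewrite -lt0n prime_gt0.
set a := numq r; set m := ((a * s) %% p%:Z)%Z.
have m0 : 0 <= m by rewrite modz_ge0.
have mp : m < p%:Z by apply: ltz_pmod; rewrite ltz_nat prime_gt0.
have mE : `|m|%N = m :> int by rewrite gez0_abs.
have ip : (`|m| < p)%N by rewrite -ltz_nat mE.
exists (Ordinal ip) => /=.
have -> : (`|m|%N)%:R = m%:~R :> rat by rewrite -[in RHS]mE.
have d0 : (denq r)%:~R != 0 :> rat by rewrite intr_eq0 denq_neq0.
have -> : r - m%:~R = (a - m * denq r)%:~R / (denq r)%:~R.
  by rewrite intrB intrM mulrBl mulfK// divq_num_den.
rewrite padic_absM padic_absV (padic_abs_unit nd) invr1 mulr1.
apply: padic_abs_dvd; have := divz_eq (a * s) p%:Z; rewrite -/m => e.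
have -> : a - m * denq r = (a * t + ((a * s) %/ p%:Z)%Z * denq r) * p%:Z.
  have -> : m = a * s - ((a * s) %/ p%:Z)%Z * p%:Z.
    by apply/eqP; rewrite eq_sym subr_eq addrC; exact/eqP.
  rewrite -{1}[a]mulr1 -st1; ring.
exact: dvdz_mull.
Qed.

(** The residue field of the p-adic integers is the prime field: far enough in
    a Cauchy sequence representing [x], all terms share the residue of one of
    them, because their differences have absolute value less than [p^-1]. *)
Lemma padic_residue (x : Qp) : padic_norm x <= 1 ->
  exists i : 'I_p, padic_norm (x - i%:R) <= q^-1.
Proof.
move=> x1; set u := padic_repr x.
have pV0 : 0 < (p%:R : rat)^-1 by rewrite invr_gt0 ltr0n prime_gt0.
have [N uN] := cseqP u pV0.
(* Otherwise all later terms would have the same absolute value, larger than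
   one, and so would [x]. *)
have uN1 : padic_abs p (u N) <= 1.
  rewrite leNgt; apply/negP => h.
  have uc n : (N <= n)%N -> padic_abs p (u n) = padic_abs p (u N).
    move=> Nn; apply: padic_abs_eq; apply: lt_trans (uN _ _ Nn (leqnn N)) _.
    by apply: lt_trans h; rewrite invf_lt1 ?ltr1n// ltr0n prime_gt0.
  move: x1; rewrite -(cvg_lim (@Rhausdorff R) (@padic_norm_cvg R p x)).
  rewrite (cvg_lim (@Rhausdorff R) (@eventually_cst_cvg R _ _ _ _ uc)).
  by rewrite leNgt -(rmorph1 (ratr : rat -> R)) ltr_rat h.
have [i ri] := padic_abs_residue uN1; exists i.
have -> : x - i%:R = padic_pi R (u - i%:R).
  rewrite padic_piD padic_piN padic_reprK; congr (_ - _).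
  by elim: (i : nat) => [|n IH]; rewrite ?padic_pi0// !mulrS padic_piD -IH padic_pi1.
have -> : q^-1 = ratr (p%:R^-1) by rewrite fmorphV/= ratr_nat.
have cv := @padic_norm_pi R p (u - i%:R).
rewrite -(cvg_lim _ cv)//; apply: limr_le; first by apply/cvg_ex; eexists; exact: cv.
exists N => // n Nn; rewrite ler_rat.
rewrite [X in padic_abs p X](_ : _ = (u n - u N) + (u N - i%:R)); last first.
  by rewrite addrA subrK -(cseq_nat p i n).
apply: le_trans (padic_abs_ultra _ _ _) _; rewrite ge_max ri andbT ltW//.
exact: uN.
Qed.

Lemma padic_norm_natB (i j : 'I_p) : i != j ->
  padic_norm (i%:R - j%:R : Qp) = 1.
Proof.
wlog ij : i j / (j < i)%N => [wl|] ne.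
  have : (i : nat) != j by [].
  rewrite neq_ltn => /orP[] lt; last exact: wl.
  by rewrite padic_normB; apply: wl => //; rewrite eq_sym.
rewrite -natrB ?(ltnW ij)// padic_norm_nat.
have -> : (i - j)%:R = (i - j)%N%:Z%:~R :> rat by [].
rewrite padic_abs_unit ?rmorph1// dvdzE /= gtnNdvd ?subn_gt0//.
by apply: leq_ltn_trans (leq_subr _ _) _.
Qed.

Lemma padic_exprz_exists (l : int) : exists x : Qp, x != 0 /\ padic_norm x = q ^ l.
Proof.
have np : padic_norm (p%:R : Qp) = q^-1.
  by rewrite padic_norm_nat padic_abs_prime fmorphV/= ratr_nat.
have nX n : padic_norm ((p%:R : Qp) ^+ n) = q^-1 ^+ n.
  by elim: n => [|n IH]; rewrite ?padic_norm1// !exprS padic_normM np IH.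
suff [x nx] : exists x : Qp, padic_norm x = q ^ l.
  exists x; split=> //; apply: contra_eq_neq nx => ->.
  by rewrite padic_norm0 lt_eqF// exprz_prime_gt0.
case: l => n; last by exists (p%:R ^+ n.+1); rewrite nX exprVn.
by exists (p%:R ^+ n)^-1; rewrite padic_normV nX exprVn invrK.
Qed.

End ValueGroup.

(** * Borel sets and functions of the norm *)

Section Measurability.
Variables (R : realType) (p : nat).
Hypothesis p_prime : prime p.
Local Notation Qp := (padic R p).
Local Notation q := (p%:R : R).

Lemma open_padic_measurable (A : set Qp) : open A -> measurable A.
Proof. exact: sub_sigma_algebra. Qed.

Lemma padic_openP (A : set Qp) :
  open A <-> forall x, A x -> exists2 e : R, 0 < e &
    forall y, padic_norm (x - y) < e -> A y.
Proof.
rewrite openE; split=> [oA x /oA|oA x /oA[e e0 eA]].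
  by rewrite /interior => /nbhs_ballP[e e0 eA]; exists e => // y xy; exact: eA.
by apply/nbhs_ballP; exists e => // y; exact: eA.
Qed.

Lemma open_padic_ball (a : Qp) (r : R) : open [set y | padic_norm (a - y) < r].
Proof.
apply/padic_openP => x /= ax.
have r0 : 0 < r by apply: le_lt_trans ax; exact: padic_norm_ge0.
by exists r => // y xy; have := padic_norm_ltD ax xy; rewrite addrA subrK.
Qed.

Lemma open_padic_cball (a : Qp) (r : R) : 0 < r ->
  open [set y | padic_norm (a - y) <= r].
Proof.
move=> r0; apply/padic_openP => x /= ax.
by exists r => // y /ltW xy; have := padic_norm_leD ax xy; rewrite addrA subrK.
Qed.

Lemma measurable_padic_sphere (a : Qp) (l : int) :
  measurable [set y | padic_norm (a - y) = q ^ l].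
Proof.
rewrite (_ : [set _ | _] = [set y | padic_norm (a - y) <= q ^ l] `\`
                           [set y | padic_norm (a - y) < q ^ l]).
  apply: measurableD; apply: open_padic_measurable; last exact: open_padic_ball.
  by apply: open_padic_cball; exact: exprz_prime_gt0.
apply/seteqP; split=> y /=; first by move=> ->; rewrite lexx ltxx.
by move=> [yl /negP]; rewrite -leNgt => ly; apply/eqP; rewrite eq_le yl.
Qed.

(** The distance to [a] takes countably many values, each of them on a Borel
    set, so that every function of it is Borel. *)
Lemma measurable_radial (a : Qp) (g : R -> R) (D : set Qp) :
  measurable_fun D (fun y => g (padic_norm (a - y))).
Proof.
apply: measurable_funTS => _ Y _; rewrite setTI.
have mS (P : R -> Prop) :
    measurable (\bigcup_l ([set y : Qp | padic_norm (a - y) = q ^ l] `&`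
                           [set _ | P (q ^ l)])).
  apply: countable_bigcupT_measurable; first exact: countableP.
  move=> l; apply: measurableI; first exact: measurable_padic_sphere.
  have [Pl|Pl] := pselect (P (q ^ l)).
    by rewrite (_ : [set _ | _] = setT)//; apply/seteqP; split.
  by rewrite (_ : [set _ | _] = set0)//; apply/seteqP; split.
(* The complement of a point is the union of the spheres around it. *)
have ma : measurable [set a].
  rewrite -[X in measurable X]setCK; apply: measurableC.
  rewrite (_ : ~` _ = \bigcup_l ([set y : Qp | padic_norm (a - y) = q ^ l] `&`
                           [set _ | True])); first exact: mS (fun=> True).
  apply/seteqP; split=> y /=.
    move=> /eqP; rewrite eq_sym -subr_eq0 => /padic_norm_exprz[l e].
    by exists l.
  move=> [l _ [/= e _] ya]; move: e; rewrite ya subrr padic_norm0 => /esym/eqP.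
  by rewrite gt_eqF// exprz_prime_gt0.
have -> : (fun y : Qp => g (padic_norm (a - y))) @^-1` Y =
    ([set a] `&` [set _ | Y (g 0)]) `|`
    \bigcup_l ([set y : Qp | padic_norm (a - y) = q ^ l] `&`
               [set _ | Y (g (q ^ l))]).
  apply/seteqP; split=> y /=.
    have [ay|] := eqVneq (a - y) 0.
      by rewrite ay padic_norm0; left; split=> //; rewrite (subr0_eq ay).
    by move=> /padic_norm_exprz[l e]; rewrite e => Yl; right; exists l.
  move=> [[-> /=]|[l _ [/= -> //]]].
  by rewrite subrr padic_norm0.
apply: measurableU; last exact: (mS (fun r => Y (g r))).
have [Pl|Pl] := pselect (Y (g 0)).
  by rewrite (_ : [set _ | Y _] = setT) ?setIT//; apply/seteqP; split.
by rewrite (_ : [set _ | Y _] = set0) ?setI0//; apply/seteqP; split.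
Qed.

Lemma measurable_radial0 (g : R -> R) (D : set Qp) :
  measurable_fun D (fun y : Qp => g (padic_norm y)).
Proof.
rewrite (_ : (fun y => _) = fun y : Qp => g (padic_norm (0 - y))).
  exact: measurable_radial.
by apply/funext => y; rewrite sub0r padic_normN.
Qed.

Lemma measurable_padic_level (a : Qp) (P : set R) : measurable P ->
  measurable [set y : Qp | P (padic_norm (a - y))].
Proof.
move=> mP; have := @measurable_radial a id setT measurableT P mP.
by rewrite setTI.
Qed.

Lemma measurable_padic_disc (r : R) : measurable (padic_disc r : set Qp).
Proof.
have := @measurable_padic_level 0 [set x | x <= r] _.
rewrite (_ : [set y | _] = padic_disc r).
  by apply; rewrite -set_itvNyc; exact: measurable_itv.
by apply/seteqP; split=> y /=; rewrite sub0r padic_normN.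
Qed.

Lemma measurable_padic_shift (a : Qp) : measurable_fun setT (fun y : Qp => y - a).
Proof.
apply: (measurability (@open Qp)) => // _ [A oA <-].
rewrite setTI; apply: open_padic_measurable; apply/padic_openP => x /= xA.
have /padic_openP/(_ _ xA)[e e0 eA] := oA.
by exists e => // y xy; apply: eA; rewrite opprB addrA subrK.
Qed.

End Measurability.

(** * Volumes of discs and invariance of integrals *)

Section Haar.
Variables (R : realType) (p : nat).
Hypothesis p_prime : prime p.
Local Notation Qp := (padic R p).
Local Notation q := (p%:R : R).
Variable mu : {measure set Qp -> \bar R}.
Hypothesis mu_haar : normalized_haar mu.

Lemma haar_cball (a : Qp) (r : R) :
  mu [set y | padic_norm (a - y) <= r] = mu (padic_disc r).
Proof.
rewrite -(mu_haar.1 a _ (measurable_padic_disc p_prime r)); congr (mu _).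
apply/seteqP; split=> y /=.
  move=> ay; exists (y - a); last by rewrite addrC subrK.
  by rewrite /padic_disc /= padic_normB.
by move=> [x + <-]; rewrite /padic_disc /= padic_normB addrC addKr.
Qed.

(** A disc is the disjoint union of [p] translates of the next smaller one,
    one for each residue. *)
Lemma haar_discS (l : int) :
  mu (padic_disc (q ^ (l + 1))) = (q%:E * mu (padic_disc (q ^ l)))%E.
Proof.
have [c [c0 nc]] := padic_exprz_exists R p_prime (l + 1).
have ql0 : 0 < q ^ l by exact: exprz_prime_gt0.
have qll : q ^ l < q ^ (l + 1).
  by rewrite exprz_primeS// ltr_pMl// natr_prime_gt1.
(* The translates are centred at the multiples [i * c] with [i < p]. *)
pose B (i : nat) := [set y : Qp | padic_norm (i%:R * c - y) <= q ^ l].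
have -> : padic_disc (q ^ (l + 1)) = \bigcup_(i in `I_p) B i.
  apply/seteqP; split=> y; rewrite /padic_disc /=.
    move=> yl; have : padic_norm (y / c) <= 1.
      by rewrite padic_normM padic_normV nc ler_pdivrMr ?mul1r// exprz_prime_gt0.
    move=> /(padic_residue p_prime)[i yi]; exists i => //=; rewrite /B /= padic_normB.
    have -> : y - i%:R * c = (y / c - i%:R) * c by rewrite mulrBl divfK.
    rewrite padic_normM nc exprz_primeS// mulrA ler_piMl ?(ltW ql0)//.
    by rewrite -ler_pdivlMr ?natr_prime_gt0// div1r.
  move=> [i ip]; rewrite /B /= padic_normB => yi.
  rewrite -(subrK (i%:R * c) y); apply: padic_norm_leD.
    by apply: le_trans yi _; exact: ltW.
  rewrite padic_normM nc ler_piMl ?(ltW (exprz_prime_gt0 _ _ _))//.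
  rewrite padic_norm_nat -(rmorph1 (ratr : rat -> R)) ler_rat.
  exact: (padic_abs_int_le1 p_prime i%:Z).
rewrite measure_fin_bigcup//; first last.
- by move=> i _; apply: open_padic_measurable; exact: open_padic_cball.
- apply/trivIsetP => i j ip jp ij; apply/seteqP; split=> // y [] /=.
  rewrite /B /= => iy jy.
  have := padic_norm_leD iy (etrans (congr1 (<= _) (padic_normB _ _)) jy).
  rewrite addrA subrK -mulrBl padic_normM nc.
  rewrite (@padic_norm_natB R p p_prime (Ordinal ip) (Ordinal jp))// mul1r.
  by rewrite leNgt qll.
rewrite (eq_fsbigr (fun=> mu (padic_disc (q ^ l)))); last first.
  by move=> i _; exact: haar_cball.
rewrite -(fsbig_ord _ _ (fun=> mu (padic_disc (q ^ l)))).
by rewrite big_const card_ord mule_natl; exact: iter_addr_0.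
Qed.

Lemma haar_disc (l : int) : mu (padic_disc (q ^ l)) = (q ^ l)%:E.
Proof.
have q0 : q != 0 by exact: natr_prime_neq0.
have pos n : mu (padic_disc (q ^ n%:Z)) = (q ^ n%:Z)%:E.
  elim: n => [|n IH]; first by rewrite expr0z mu_haar.2.
  rewrite (_ : n.+1%:Z = n%:Z + 1); last by rewrite -addn1 PoszD.
  by rewrite haar_discS IH -EFinM exprz_primeS.
have neg n : mu (padic_disc (q ^ (- n%:Z))) = (q ^ (- n%:Z))%:E.
  elim: n => [|n IH]; first by rewrite oppr0 expr0z mu_haar.2.
  have := haar_discS (- n.+1%:Z).
  have -> : - n.+1%:Z + 1 = - n%:Z by lia.
  rewrite IH => /(congr1 (fun x => (q^-1%:E * x)%E)).
  rewrite muleA -!EFinM mulVf// mul1e => <-; congr _%:E.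
  apply: (mulfI q0); rewrite mulrA divff// mul1r -exprz_primeS//.
  by congr (_ ^ _); lia.
by case: (intP l) => [|n|n]; [exact: (pos 0%N)|exact: pos|exact: neg].
Qed.

(** Invariance says that the image of Haar measure under a translation is Haar
    measure; the three lemmas after this one transfer it to integrals. *)
Lemma haar_preimage_shift (a : Qp) (A : set Qp) : measurable A ->
  mu [set y | A (y - a)] = mu A.
Proof.
move=> mA; rewrite -(mu_haar.1 a _ mA); congr (mu _).
apply/seteqP; split=> y /=; first by exists (y - a) => //; rewrite addrC subrK.
by move=> [x + <-]; rewrite addrAC subrr add0r.
Qed.

Lemma ge0_integral_shift (a : Qp) (D : set Qp) (f : Qp -> \bar R) :
  measurable D -> measurable_fun D f -> (forall y, 0 <= f y)%E ->
  (\int[mu]_(y in [set y | D (y - a)%R]) f (y - a)%R = \int[mu]_(y in D) f y)%E.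
Proof.
move=> mD mf f0.
rewrite -[LHS](@ge0_integral_pushforward _ _ _ _ _ _
  (measurable_padic_shift a) mu D f)//.
apply: eq_measure_integral => [|mphi A mA _]; first exact: measurable_padic_shift.
exact: haar_preimage_shift.
Qed.

Lemma integrable_shift (a : Qp) (D : set Qp) (f : Qp -> \bar R) :
  measurable D -> measurable_fun setT f -> mu.-integrable D f ->
  mu.-integrable [set y | D (y - a)] (fun y => f (y - a)).
Proof.
move=> mD mf /integrableP[_ foo]; apply/integrableP; split.
  apply: measurable_funTS; apply: (measurableT_comp mf).
  exact: measurable_padic_shift.
rewrite (ge0_integral_shift a mD (f := fun y => `|f y|%E))//.
by apply: measurableT_comp => //; exact: measurable_funTS.
Qed.

Lemma integral_shift (a : Qp) (D : set Qp) (f : Qp -> \bar R) :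
  measurable D -> measurable_fun setT f -> mu.-integrable D f ->
  (\int[mu]_(y in [set y | D (y - a)%R]) f (y - a)%R = \int[mu]_(y in D) f y)%E.
Proof.
move=> mD mf fi.
rewrite -[LHS](@integral_pushforward _ _ _ _ _ _
  (measurable_padic_shift a) mu D f)//.
  apply: eq_measure_integral => [|mphi A mA _]; first exact: measurable_padic_shift.
  exact: haar_preimage_shift.
exact: integrable_shift.
Qed.

End Haar.

(** * Integrability of functions of the norm *)

Section RadialIntegrability.
Variables (R : realType) (p : nat).
Hypothesis p_prime : prime p.
Local Notation Qp := (padic R p).
Local Notation q := (p%:R : R).
Variable mu : {measure set Qp -> \bar R}.
Hypothesis mu_haar : normalized_haar mu.

Lemma measurable_padic0 : measurable [set 0 : Qp].
Proof.
rewrite (_ : [set 0] = padic_disc 0); first exact: measurable_padic_disc.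
apply/seteqP; split=> y; rewrite /padic_disc /=.
  by move=> ->; rewrite padic_norm0.
by move=> y0; apply: padic_norm_eq0; apply/eqP; rewrite eq_le y0 padic_norm_ge0.
Qed.

(** The point lies in discs of arbitrarily small volume. *)
Lemma haar_set0 : mu [set 0] = 0%E.
Proof.
apply/eqP; rewrite eq_le measure_ge0 andbT; apply/lee_addgt0Pr => e e0; rewrite add0e.
have [k ke] : exists k : nat, q ^ (- k%:Z) <= e.
  exists (Num.truncn e^-1).+1; rewrite -exprnN -[leRHS]invrK.
  rewrite lef_pV2 ?posrE ?invr_gt0 ?exprn_gt0 ?natr_prime_gt0//.
  apply: le_trans (ltW (truncnS_gt _)) _.
  by rewrite -natrX ler_nat ltnW// ltn_expl// prime_gt1.
apply: (@le_trans _ _ (q ^ (- k%:Z))%:E); last by rewrite lee_fin.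
rewrite -(haar_disc p_prime mu_haar); apply: le_measure; rewrite ?inE.
- exact: measurable_padic0.
- exact: measurable_padic_disc.
- by move=> y ->; rewrite /padic_disc /= padic_norm0 ltW// exprz_prime_gt0.
Qed.

Lemma geometric_nneseries_lty (a r : R) : 0 <= a -> 0 < r < 1 ->
  (\sum_(0 <= k <oo) (a * r ^+ k)%:E < +oo)%E.
Proof.
move=> a0 /andP[r0 r1].
apply: (@le_lt_trans _ _ (a * (1 - r)^-1)%:E); last exact: ltry.
apply: lime_le.
  by apply: is_cvg_nneseries => n _ _; rewrite lee_fin mulr_ge0// exprn_ge0// ltW.
apply: nearW => n; rewrite sumEFin lee_fin.
by apply: (@geometric_le_lim R n a r) => //; rewrite gtr0_norm.
Qed.

(** Up to its centre, which is a null set, the disc is a union of spheres. The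
    one of radius [q ^ l] has volume at most [q ^ l], so the integral is
    dominated by a geometric series of ratio [q `^ (- (s + 1))], which is less
    than one. *)
Lemma integrable_radial (n : int) (g : R -> R) (C s : R) : -1 < s ->
  (forall l : int, l <= n -> `|g (q ^ l)| <= C * (q ^ l) `^ s) ->
  mu.-integrable (padic_disc (q ^ n)) (fun y => (g (padic_norm y))%:E).
Proof.
move=> s1 gC; set f := fun y : Qp => (g (padic_norm y))%:E.
have mf D : measurable_fun D f.
  by apply/measurable_EFinP; exact: measurable_radial0.
apply/(negligible_integrable measurable_padic0 _ _ haar_set0) => //.
  exact: measurable_padic_disc.
pose S (k : nat) := [set y : Qp | padic_norm y = q ^ (n - k%:Z)].
have mS k : measurable (S k).
  rewrite (_ : S k = [set y | padic_norm (0 - y) = q ^ (n - k%:Z)]).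
    exact: measurable_padic_sphere.
  by apply/seteqP; split=> y; rewrite /S /= sub0r padic_normN.
have -> : padic_disc (q ^ n) `\` [set 0] = \bigcup_k S k.
  apply/seteqP; split=> y; rewrite /padic_disc /=.
    move=> [yn /eqP/padic_norm_exprz[l yl]].
    have ln : l <= n by rewrite -(ler_eXz2l (natr_prime_gt1 R p_prime)) -yl.
    exists `|n - l|%N => //; rewrite /S /= yl; congr (_ ^ _); lia.
  move=> [k _]; rewrite /S /= => yk; split.
    by rewrite yk (ler_eXz2l (natr_prime_gt1 R p_prime)); lia.
  move=> y0; move: yk; rewrite y0 padic_norm0 => /esym/eqP.
  by rewrite gt_eqF// exprz_prime_gt0.
have tS : trivIset setT S.
  apply/trivIsetP => i j _ _ ij; apply/seteqP; split=> // y; rewrite /S /=.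
  move=> [-> /(exprz_prime_inj p_prime) e]; move: ij => /eqP; apply; lia.
have C0 : 0 <= C.
  have := le_trans (normr_ge0 _) (gC n (lexx n)).
  by rewrite pmulr_lge0// powR_gt0// exprz_prime_gt0.
apply/integrableP; split; first exact: mf.
rewrite ge0_integral_bigcup//; last by apply: measurableT_comp => //; exact: mf.
apply: le_lt_trans (@geometric_nneseries_lty (C * (q ^ n) `^ (s + 1))
  (q `^ (- (s + 1))) _ _).
- apply: lee_nneseries => [k _ _|k _]; first exact: integral_ge0.
  have qge0 (l : int) : 0 <= q ^ l by apply: ltW; exact: exprz_prime_gt0.
  have ql0 : 0 < q ^ (n - k%:Z) by exact: exprz_prime_gt0.
  apply: (@le_trans _ _ (`|g (q ^ (n - k%:Z))|%:E * mu (S k))%E).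
    rewrite -integral_cst//.
    rewrite le_eqVlt; apply/orP; left; apply/eqP/eq_integral => y.
    by rewrite inE /S /f /= => ->.
  apply: (@le_trans _ _ ((C * (q ^ (n - k%:Z)) `^ s)%:E * (q ^ (n - k%:Z))%:E)%E).
    apply: lee_pmul => //; first by rewrite lee_fin gC//; lia.
    rewrite -(haar_disc p_prime mu_haar); apply: le_measure; rewrite ?inE//.
      exact: measurable_padic_disc.
    by move=> y; rewrite /S /padic_disc /= => ->.
  rewrite -EFinM lee_fin -!mulrA ler_wpM2l//.
  rewrite -{2}(powRr1 (ltW ql0)) -powRD; last by rewrite (gt_eqF ql0) implybT.
  rewrite expfzDr ?natr_prime_neq0// powRM ?qge0//.
  rewrite ler_wpM2l ?powR_ge0// -powR_mulrn ?powR_ge0// -powRrM.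
  rewrite -powR_intmul ?ler0n// -powRrM.
  by rewrite rmorphN /= (mulrC _ (s + 1)) mulrN -mulNr.
- by rewrite mulr_ge0// powR_ge0.
- rewrite powR_gt0 ?natr_prime_gt0//=.
  have s10 : 0 < s + 1 by lra.
  rewrite powRN invf_lt1 ?powR_gt0 ?natr_prime_gt0//.
  have := @gt0_ltr_powR R _ s10 1 q; rewrite powR1; apply.
  - by rewrite nnegrE.
  - by rewrite nnegrE ler0n.
  - exact: natr_prime_gt1.
Qed.

End RadialIntegrability.

(** * Fixed points of bounded Lipschitz functions *)

Section FixedPoint.
Variable R : realType.

Lemma lipschitz_continuousR (phi : R -> R) (K : R) :
  (forall x y, `|phi x - phi y| <= K * `|x - y|) -> continuous phi.
Proof.
move=> lip x; apply/cvgrPdist_lt => e e0.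
have K1 : 0 < `|K| + 1 by rewrite ltr_wpDl.
near=> y; apply: le_lt_trans (lip x y) _.
apply: (@le_lt_trans _ _ ((`|K| + 1) * `|x - y|)).
  by rewrite ler_wpM2r// (le_trans (ler_norm K))// lerDl.
rewrite mulrC -ltr_pdivlMr//; near: y.
by apply: (@cvgr_dist_lt _ _ _ _ _ id x); rewrite ?divr_gt0//; exact: cvg_id.
Unshelve. all: by end_near. Qed.

(** The function [z - b * phi z] is at most [a] at [a - |b| M] and at least [a]
    at [a + |b| M]; the intermediate value theorem applies for every [b], where
    a contraction argument would ask for a small one. *)
Lemma bounded_affine_fixpoint (phi : R -> R) (M a b : R) :
  continuous phi -> (forall x, `|phi x| <= M) -> exists z, z = a + b * phi z.
Proof.
move=> cphi bphi; set c := `|b| * M.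
have bM x : - c <= b * phi x <= c.
  by rewrite -ler_norml normrM ler_wpM2l.
have c0 : 0 <= c by case/andP: (bM 0) => h1 h2; lra.
have [|||z _ ez] := @IVT R (fun z => z - b * phi z) (a - c) (a + c) a.
- lra.
- apply: continuous_subspaceT => z; apply: cvgB; first exact: cvg_id.
  by apply: cvgM; [exact: cvg_cst | exact: cphi].
- have /andP[h1 h2] := bM (a - c); have /andP[h3 h4] := bM (a + c).
  by rewrite ge_min le_max; apply/andP; split; apply/orP; [left|right]; lra.
by exists z; lra.
Qed.

End FixedPoint.


(** * The fractional integral of a radial function *)

Section RadialFractionalIntegral.
Variables (R : realType) (p : nat).
Hypothesis p_prime : prime p.
Local Notation Qp := (padic R p).
Local Notation q := (p%:R : R).
Variable mu : {measure set Qp -> \bar R}.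
Hypothesis mu_haar : normalized_haar mu.

(** The function of one variable of which the kernel of the fractional integral
    is a difference: the Riesz potential, or the logarithm at its pole
    [alpha = 1]. *)
Definition riesz_kernel (alpha r : R) : R :=
  if alpha == 1 then ln r else r `^ (alpha - 1).

Lemma frac_kernelE (alpha : R) (x y : Qp) : frac_kernel alpha x y =
  riesz_kernel alpha (padic_norm (x - y)) - riesz_kernel alpha (padic_norm y).
Proof. by rewrite /frac_kernel /riesz_kernel; case: eqP. Qed.

(** Apply [ln x <= x] to [x = r `^ e] and to [x = r `^ (- e)]. *)
Lemma norm_ln_le_powR (e r : R) : 0 < e -> 0 < r ->
  `|ln r| <= (r `^ e + r `^ (- e)) / e.
Proof.
move=> e0 r0; rewrite ler_pdivlMr// -[X in _ * X](gtr0_norm e0) -normrM.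
have h (s : R) : s * ln r <= r `^ s.
  by rewrite -ln_powR ltW// ln_sublinear// powR_gt0.
have h1 := h e; have h2 := h (- e); have := powR_ge0 r e; have := powR_ge0 r (- e).
by move=> h3 h4; rewrite mulrC ler_norml; apply/andP; split; lra.
Qed.

(** The inequality [gamma - 1 < s] makes both [r `^ s] and [r `^ (s - gamma)]
    integrable near zero. For [alpha = 1] the logarithm is controlled by a
    small negative power. *)
Lemma riesz_kernel_bound (alpha gamma : R) (n : int) :
  0 < alpha -> gamma < Num.min 1 alpha ->
  exists C s : R, gamma - 1 < s /\ forall l : int, l <= n ->
    `|riesz_kernel alpha (q ^ l)| <= C * (q ^ l) `^ s.
Proof.
move=> a0; rewrite lt_min => /andP[g1 ga].
rewrite /riesz_kernel; have [_|a1] := eqVneq alpha 1; last first.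
  exists 1, (alpha - 1); split=> [|l _]; first by lra.
  by rewrite mul1r ger0_norm// powR_ge0.
(* Any exponent strictly between zero and [1 - gamma] would do. *)
set e := (1 - gamma) / 2.
have e0 : 0 < e by rewrite /e; lra.
exists (((q ^ n) `^ (2 * e) + 1) / e), (- e); split=> [|l le_l_n].
  by rewrite /e; lra.
have ql0 := exprz_prime_gt0 R p_prime l.
apply: le_trans (norm_ln_le_powR e0 ql0) _.
rewrite mulrAC ler_wpM2r ?invr_ge0 ?(ltW e0)// mulrDl mul1r lerD2r.
have -> : (q ^ l) `^ e = (q ^ l) `^ (2 * e) * (q ^ l) `^ (- e).
  by rewrite -powRD; [congr (_ `^ _); lra | rewrite (gt_eqF ql0) implybT].
rewrite ler_wpM2r ?powR_ge0// ge0_ler_powR//; first by lra.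
- by rewrite nnegrE ltW.
- by rewrite nnegrE ltW// exprz_prime_gt0.
- by rewrite (ler_eXz2l (natr_prime_gt1 R p_prime)).
Qed.

Lemma padic_disc_shift (x : Qp) (r : R) : padic_norm x <= r ->
  [set y | padic_disc r (y - x)] = padic_disc r.
Proof.
move=> xr; apply/seteqP; split=> y; rewrite /padic_disc /= => yr.
  by rewrite -(subrK x y) padic_norm_leD.
by rewrite padic_norm_leD// padic_normN.
Qed.

Section Formula.
Variables (alpha gamma M : R).
Hypotheses (alpha_gt0 : 0 < alpha) (gamma_gt0 : 0 < gamma).
Hypothesis gamma_lt : gamma < Num.min 1 alpha.
Variables (n : int) (w : R -> R).
Hypothesis w_bound : forall l : int, `|w (q ^ l)| <= M * (q ^ l) `^ (- gamma).
Local Notation D := (padic_disc (q ^ n) : set Qp).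
Local Notation k := (riesz_kernel alpha).

Let mD : measurable D. Proof. exact: measurable_padic_disc. Qed.

Let intD (g h : Qp -> R) : mu.-integrable D (EFin \o g) ->
  mu.-integrable D (EFin \o h) -> mu.-integrable D (EFin \o (fun y => g y + h y)).
Proof. exact: integrableD. Qed.

Let intZ (c : R) (g : Qp -> R) : mu.-integrable D (EFin \o g) ->
  mu.-integrable D (EFin \o (fun y => c * g y)).
Proof. exact: integrableZl. Qed.

Let intB (g h : Qp -> R) : mu.-integrable D (EFin \o g) ->
  mu.-integrable D (EFin \o h) -> mu.-integrable D (EFin \o (fun y => g y - h y)).
Proof. exact: integrableB. Qed.

Lemma integrable_riesz_kernel :
  mu.-integrable D (EFin \o (fun y : Qp => k (padic_norm y))).
Proof.
have [C [s [gs kC]]] := riesz_kernel_bound n alpha_gt0 gamma_lt.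
apply: (integrable_radial p_prime mu_haar (C := C) (s := s)) => //.
by apply: lt_trans gs; rewrite -[ltLHS]add0r ltrD2r.
Qed.

Lemma integrable_riesz_kernel_mul :
  mu.-integrable D (EFin \o (fun y : Qp => k (padic_norm y) * w (padic_norm y))).
Proof.
have [C [s [gs kC]]] := riesz_kernel_bound n alpha_gt0 gamma_lt.
apply: (integrable_radial p_prime mu_haar (g := fun r => k r * w r)
  (C := C * M) (s := s - gamma)).
  by rewrite ltrBrDr addrC.
move=> l le_l_n; have ql0 := exprz_prime_gt0 R p_prime l.
rewrite normrM powRD; last by rewrite (gt_eqF ql0) implybT.
by rewrite mulrACA ler_pM// kC.
Qed.

Lemma integrable_weight : mu.-integrable D (EFin \o (fun y : Qp => w (padic_norm y))).
Proof.
apply: (integrable_radial p_prime mu_haar (C := M) (s := - gamma)) => //.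
by move: gamma_lt; rewrite lt_min ltrN2 => /andP[].
Qed.

Lemma integrable_disc_cst (c : R) : mu.-integrable D (EFin \o cst c).
Proof.
apply: (integrable_radial p_prime mu_haar (g := cst c) (C := `|c|) (s := 0)).
  by rewrite ltrN10.
by move=> l _; rewrite powRr0 mulr1.
Qed.

(** Since [|x| = q ^ n], the translation by [x] preserves the disc, so the two
    terms of the kernel have the same integral over it. *)
Lemma frac_kernel_mean0 (x : Qp) : padic_norm x = q ^ n ->
  mu.-integrable D (EFin \o (fun y => frac_kernel alpha x y)) /\
  \int[mu]_(y in D) frac_kernel alpha x y = 0.
Proof.
move=> xn; have xD : padic_norm x <= q ^ n by rewrite xn.
have mk : measurable_fun setT (EFin \o (fun y : Qp => k (padic_norm y))).
  by apply/measurable_EFinP; exact: measurable_radial0.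
have i1 := integrable_shift mu_haar x mD mk integrable_riesz_kernel.
have e1 := integral_shift mu_haar x mD mk integrable_riesz_kernel.
rewrite (padic_disc_shift xD) in i1 e1.
have -> : (fun y => frac_kernel alpha x y) =
    fun y => k (padic_norm (y - x)) - k (padic_norm y).
  by apply/funext => y; rewrite frac_kernelE padic_normB.
split; first exact: (intB i1 integrable_riesz_kernel).
rewrite (RintegralB mD i1 integrable_riesz_kernel); apply/eqP; rewrite subr_eq0.
by apply/eqP; exact: (congr1 fine e1).
Qed.

(** Over the whole disc the kernel has integral zero, so subtracting the value
    of the density on the outer sphere does not change the integral; but the
    difference vanishes on that sphere, and inside it the kernel is radial. *)
Lemma frac_integral_radial (x : Qp) : padic_norm x = q ^ n ->
  frac_defined mu alpha (fun y => w (padic_norm y)) x /\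
  frac_integral mu alpha (fun y => w (padic_norm y)) x = frac_const p alpha *
    (\int[mu]_(y in D) ((k (q ^ n) - k (padic_norm y)) * w (padic_norm y)) -
     w (q ^ n) * \int[mu]_(y in D) (k (q ^ n) - k (padic_norm y))).
Proof.
move=> xn; rewrite /frac_defined /frac_integral xn.
pose G1 (y : Qp) := (k (q ^ n) - k (padic_norm y)) * w (padic_norm y).
pose G0 (y : Qp) := k (q ^ n) - k (padic_norm y).
have iG0 : mu.-integrable D (EFin \o G0).
  exact: (intB (integrable_disc_cst _) integrable_riesz_kernel).
have iG1 : mu.-integrable D (EFin \o G1).
  rewrite (_ : G1 = fun y => k (q ^ n) * w (padic_norm y) -
                             k (padic_norm y) * w (padic_norm y)).
    exact: (intB (intZ _ integrable_weight) integrable_riesz_kernel_mul).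
  by apply/funext => y; rewrite /G1 mulrBl.
have [iK eK] := frac_kernel_mean0 xn.
(* [H] is the integrand on the disc, split as the radial function
   [(k (q ^ n) - k r) * (w r - w (q ^ n))] and a multiple of the kernel. *)
pose H y := (G1 y - w (q ^ n) * G0 y) + w (q ^ n) * frac_kernel alpha x y.
have HE : {in D, H =1 fun y => frac_kernel alpha x y * w (padic_norm y)}.
  move=> y; rewrite inE /H /G1 /G0 /padic_disc /= => yn; rewrite frac_kernelE.
  have [->|ne] := eqVneq (padic_norm y) (q ^ n); first by ring.
  rewrite padic_norm_domin ?xn; first by ring.
  by rewrite lt_neqAle ne.
have iH : mu.-integrable D (EFin \o H).
  exact: (intD (intB iG1 (intZ _ iG0)) (intZ _ iK)).
split.
  by apply: eq_integrable iH => // y yD; rewrite /= HE.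
congr (_ * _); rewrite -(eq_Rintegral _ HE).
rewrite /H (RintegralD mD (intB iG1 (intZ _ iG0)) (intZ _ iK)).
rewrite (RintegralB mD iG1 (intZ _ iG0)) (RintegralZl _ mD iG0).
rewrite (RintegralZl _ mD iK) eK.
by rewrite mulr0 addr0.
Qed.

End Formula.
End RadialFractionalIntegral.

(** * Extension across one sphere, and to the whole field *)

Section Extension.
Variables (R : realType) (p : nat).
Hypothesis p_prime : prime p.
Local Notation Qp := (padic R p).
Local Notation q := (p%:R : R).
Variable mu : {measure set Qp -> \bar R}.
Hypothesis mu_haar : normalized_haar mu.
Variables (alpha gamma u0 : R) (f : R -> R -> R).

(** The equation at [t] only sees the disc of radius [|t|]. *)
Lemma solves_at_eq (u v : Qp -> R) (t : Qp) :
  (forall y, padic_norm y <= padic_norm t -> u y = v y) ->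
  solves_at mu alpha gamma u0 f u t -> solves_at mu alpha gamma u0 f v t.
Proof.
move=> uv [ui ue]; split.
  apply: eq_integrable ui; first exact: measurable_padic_disc.
  by move=> y; rewrite inE /padic_disc /= => yt; rewrite uv.
rewrite -uv// ue /frac_integral; congr (_ + _ * _).
by apply: eq_Rintegral => y; rewrite inE /padic_disc /= => yt; rewrite uv.
Qed.

Hypotheses (alpha_gt0 : 0 < alpha) (gamma_gt0 : 0 < gamma).
Hypothesis gamma_lt : gamma < Num.min 1 alpha.
Variable M : R.
Hypothesis f_bounded : forall (l : int) (x : R), `|f (q ^ l) x| <= M.
Hypothesis f_continuous : forall l : int, continuous (f (q ^ l)).

(** On the sphere of radius [q ^ n] the equation is a scalar equation for the
    value taken there, of the form [z = a + b * f (q ^ n) z], because all other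
    terms only involve the values inside the sphere. *)
Lemma extend_to_sphere (n : int) (h : R -> R) : exists z : R,
  forall t : Qp, padic_norm t = q ^ n ->
  solves_at mu alpha gamma u0 f
    (fun y => if padic_norm y == q ^ n then z else h (padic_norm y)) t.
Proof.
pose k := riesz_kernel alpha.
pose D := padic_disc (q ^ n) : set Qp.
pose A := frac_const p alpha * \int[mu]_(y in D)
  ((k (q ^ n) - k (padic_norm y)) *
   (padic_norm y `^ (- gamma) * f (padic_norm y) (h (padic_norm y)))).
pose B := frac_const p alpha * \int[mu]_(y in D) (k (q ^ n) - k (padic_norm y)).
have [z ez] := bounded_affine_fixpoint (u0 + A) (- ((q ^ n) `^ (- gamma) * B))
  (@f_continuous n) (f_bounded n).
exists z => t tn.
pose w r := r `^ (- gamma) * f r (if r == q ^ n then z else h r).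
have w_bound (l : int) : `|w (q ^ l)| <= M * (q ^ l) `^ (- gamma).
  by rewrite normrM mulrC (ger0_norm (powR_ge0 _ _)) ler_wpM2r ?powR_ge0.
have [wi we] :=
  frac_integral_radial p_prime mu_haar alpha_gt0 gamma_gt0 gamma_lt w_bound tn.
split; first exact: wi.
rewrite [frac_integral _ _ _ _]we tn eqxx {1}ez.
have -> : w (q ^ n) = (q ^ n) `^ (- gamma) * f (q ^ n) z by rewrite /w eqxx.
suff -> : A = frac_const p alpha * \int[mu]_(y in D)
    ((k (q ^ n) - k (padic_norm y)) * w (padic_norm y)).
  by rewrite /B /D /k; ring.
congr (_ * _); apply: eq_Rintegral => y _; rewrite /w.
by case: eqP => // ->; rewrite subrr !mul0r.
Qed.

End Extension.

Theorem theorem4p1 (R : realType) (p : nat) (p_prime : prime p)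
  (mu : {measure set (padic R p) -> \bar R}) (mu_haar : normalized_haar mu)
  (alpha gamma u0 : R) (alpha_gt0 : 0 < alpha) (gamma_gt0 : 0 < gamma)
  (gamma_lt : gamma < Num.min 1 alpha)
  (f : R -> R -> R) (M : R)
  (f_bounded : forall (l : int) (x : R), `|f (p%:R ^ l) x| <= M)
  (F : int -> R)
  (f_lipschitz : forall (l : int) (x y : R),
     `|f (p%:R ^ l) x - f (p%:R ^ l) y| <= F l * `|x - y|)
  (F_bounds : forall l : int, 0 < F l < p%:R `^ (- alpha * l%:~R))
  (N : int) (u : padic R p -> R)
  (u_radial : radial_on (padic_disc (p%:R ^ N)) u)
  (u_local : forall t : padic R p, padic_norm t <= p%:R ^ N ->
     solves_at mu alpha gamma u0 f u t) :
  exists v : padic R p -> R,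
    [/\ radial_on setT v,
        forall t : padic R p, padic_norm t <= p%:R ^ N -> v t = u t
      & forall t : padic R p, solves_at mu alpha gamma u0 f v t].
Proof.
have q1 := natr_prime_gt1 R p_prime.
have f_cont l : continuous (f (p%:R ^ l)) := lipschitz_continuousR (f_lipschitz l).
have [g ug] := u_radial.
have [e eP] := choice (fun nh : int * (R -> R) =>
  extend_to_sphere p_prime mu_haar u0 alpha_gt0 gamma_gt0 gamma_lt f_bounded
    f_cont nh.1 nh.2).
(* [H j] solves the equation on the disc of radius [p ^ (N + j)]; passing to
   [j + 1] changes it on the next sphere only. *)
pose H := fix H (j : nat) : R -> R := if j is i.+1
  then fun r => if r == p%:R ^ (N + j%:Z) then e (N + j%:Z, H i) else H i r
  else g.
have HS i j r : r <= p%:R ^ (N + i%:Z) -> H (i + j)%N r = H i r.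
  move=> ri; elim: j => [|j IH]; first by rewrite addn0.
  rewrite addnS /= IH; case: eqP => // er; move: ri.
  by rewrite er ler_eXz2l//; lia.
have /choice[J JP] (r : R) : exists j : nat, r <= p%:R ^ (N + j%:Z).
  exists (`|N| + (Num.truncn r).+1)%N.
  apply: le_trans (ltW (truncnS_gt r)) _.
  apply: (@le_trans _ _ (p%:R ^ ((Num.truncn r).+1%:Z))).
    by rewrite -exprnP -natrX ler_nat ltnW// ltn_expl// prime_gt1.
  by rewrite ler_eXz2l//; lia.
(* By [HS] the choice of a stage [J r] that reaches [r] is immaterial. *)
pose h r := H (J r) r.
have hE i r : r <= p%:R ^ (N + i%:Z) -> h r = H i r.
  by move=> ri; rewrite /h -(HS _ i _ (JP r)) addnC HS.
have hu t : padic_norm t <= p%:R ^ N -> h (padic_norm t) = u t.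
  by move=> tN; rewrite (hE 0%N) ?addr0//= ug.
have Hsol j (t : padic R p) : padic_norm t <= p%:R ^ (N + j%:Z) ->
    solves_at mu alpha gamma u0 f (fun y => H j (padic_norm y)) t.
  elim: j t => [|j IH] t tj.
    rewrite addr0 in tj; apply: (@solves_at_eq _ _ p_prime) (u_local t tj) => y yt.
    by rewrite ug//; exact: le_trans yt tj.
  have [tj'|tj'] := leP (padic_norm t) (p%:R ^ (N + j%:Z)).
    apply: (@solves_at_eq _ _ p_prime) (IH t tj') => y yt.
    by rewrite -[j.+1]addn1 HS//; exact: le_trans yt tj'.
  have t0 : t != 0.
    apply: contraTneq tj' => ->.
    by rewrite padic_norm0 -leNgt ltW// exprz_prime_gt0.
  apply: (eP (N + j.+1%:Z, H j)) => /=.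
  have [l tl] := padic_norm_exprz t0; move: tj tj'; rewrite tl.
  by rewrite ler_eXz2l// ltr_eXz2l// => lj jl; congr (_ ^ _); lia.
exists (fun t => h (padic_norm t)); split=> //; first by exists h.
move=> t.
apply: (@solves_at_eq _ _ p_prime) (Hsol _ _ (JP (padic_norm t))) => y yt.
by rewrite (hE (J (padic_norm t)))//; exact: le_trans yt (JP _).
Qed.
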